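(* Let $C$ be a special timelike Frenet curve in $E_1^4$, parametrized by arc-length by $\mathbf{c}:I\to E_1^4$, with first curvature function $k_1$ and second curvature function $k_2$. If $C$ is a generalized timelike Mannheim curve, then there is a constant number $\beta$ such that $$k_1(t)=-\beta\left(k_1^2(t)-k_2^2(t)\right)\qquad\text{for all } t\in I.$$
   Context: $E_1^4$ is Minkowski space-time: $\mathbb{R}^4$ with the metric $\langle\,,\,\rangle=-dx_1^2+dx_2^2+dx_3^2+dx_4^2$, and $\|v\|=\sqrt{|\langle v,v\rangle|}$. A vector $v$ is timelike if $\langle v,v\rangle<0$; a curve is timelike if all its velocity vectors are timelike. All curves are regular and $C^\infty$; $I\subset\mathbb{R}$ is an interval. A timelike curve $C$ parametrized by arc-length by $\mathbf{c}:I\to E_1^4$ (so $\langle \mathbf{c}',\mathbf{c}'\rangle=-1$) is a special timelike Frenet curve if there are smooth functions $k_1>0$, $k_2>0$, $k_3\neq 0$ (nowhere zero) on $I$ and a smooth positively oriented frame field $\{T,N,B_1,B_2\}$ along $C$ with $T=\mathbf{c}'$, mutually orthogonal, $\langle T,T\rangle=-1$, $\langle N,N\rangle=\langle B_1,B_1\rangle=\langle B_2,B_2\rangle=1$, such that $$T'=k_1N,\quad N'=k_1T+k_2B_1,\quad B_1'=-k_2N+k_3B_2,\quad B_2'=-k_3B_1 .$$ The functions $k_1,k_2,k_3$ are the first, second and third curvature functions. The first, second and third normal lines of $C$ at the point $\mathbf{c}(t)$ are the lines through $\mathbf{c}(t)$ in the directions $N(t)$, $B_1(t)$, $B_2(t)$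 respectively. Objects belonging to a second curve $C^*$ are marked with $*$. A special timelike Frenet curve $C$ in $E_1^4$ is a generalized timelike Mannheim curve if there exist a special timelike Frenet curve $C^*$ in $E_1^4$ and a bijection $\phi:C\to C^*$ such that the first normal line at each point of $C$ is included in the plane generated by the second normal line and the third normal line of $C^*$ at the corresponding point under $\phi$. The curve $C^*$ is then called the generalized timelike Mannheim mate curve of $C$. By convention the mate curve is given by $\mathbf{c}^*(f(t))=\mathbf{c}(t)+\beta(t)N(t)$, $t\in I$, where $\beta$ is a smooth function on $I$, $t^*=f(t)=\int_0^t\left\|\frac{d}{dt}\left(\mathbf{c}(t)+\beta(t)N(t)\right)\right\|dt$ is the arc-length parameter of $C^*$, and $\phi(\mathbf{c}(t))=\mathbf{c}^*(f(t))$. *)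

(* Defs.v *)
From HB Require Import structures.
From mathcomp Require Import all_boot all_order all_algebra.
From mathcomp Require Import all_classical all_reals all_analysis.

Set Implicit Arguments.
Unset Strict Implicit.
Unset Printing Implicit Defensive.

Import Order.TTheory GRing.Theory Num.Theory.
Import numFieldNormedType.Exports.

Local Open Scope classical_set_scope.
Local Open Scope ring_scope.

(* The norm that the library puts on 'rV[R]_4 is only used for its topology,
   the usual one of R^4; the Minkowski norm is mnorm below. *)
Section Minkowski.
Variable R : realType.
Implicit Types u v : 'rV[R]_4.

Definition mink u v : R :=
  \sum_(i < 4) (-1) ^+ (i == ord0) * u ord0 i * v ord0 i.

Definition mnorm v : R := Num.sqrt `|mink v v|.

Definition positively_oriented (v1 v2 v3 v4 : 'rV[R]_4) : Prop :=
  0 < \det (\matrix_(i < 4) nth 0 [:: v1; v2; v3; v4] i).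

Definition line_through (p v : 'rV[R]_4) : set 'rV[R]_4 :=
  [set p + s *: v | s in [set: R]].

Definition plane_through (p v w : 'rV[R]_4) : set 'rV[R]_4 :=
  [set x | exists a b : R, x = p + a *: v + b *: w].

End Minkowski.

Section CalculusOnIntervals.
Variable R : realType.

(* An interval may contain its endpoints, so derivatives are taken relative to
   it: the increments h are restricted to those with t + h in I, and at an
   endpoint this is the one-sided derivative. *)
Definition proper_interval (I : set R) : Prop :=
  is_interval I /\ exists a b, [/\ I a, I b & a < b].

Definition diff_quot_in (V : normedModType R) (I : set R) (f : R -> V) (t : R) :
    set_system V :=
  (fun h : R => h^-1 *: (f (t + h) - f t)) @ within [set h | I (t + h)] 0^'.

Definition derivable_in (V : normedModType R) (I : set R) (f : R -> V) (t : R) :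
    Prop := cvg (diff_quot_in I f t).

Definition derive_in (V : normedModType R) (I : set R) (f : R -> V) (t : R) :
    V := lim (diff_quot_in I f t).

Definition smooth_in (V : normedModType R) (I : set R) (f : R -> V) : Prop :=
  forall (n : nat) (t : R), I t -> derivable_in I (iter n (derive_in I) f) t.

Definition oriented_integral (g : R -> R) (a b : R) : R :=
  if a <= b then \int[lebesgue_measure]_(x in `[a, b]) g x
  else - \int[lebesgue_measure]_(x in `[b, a]) g x.

End CalculusOnIntervals.

Record frenet_apparatus (R : realType) := FrenetApparatus {
  fT : R -> 'rV[R]_4;
  fN : R -> 'rV[R]_4;
  fB1 : R -> 'rV[R]_4;
  fB2 : R -> 'rV[R]_4;
  k1 : R -> R;
  k2 : R -> R;
  k3 : R -> R
}.

Section FrenetCurves.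
Variable R : realType.
Implicit Types (I : set R) (c : R -> 'rV[R]_4) (F : frenet_apparatus R).

Definition timelike_arclength_curve I c : Prop :=
  [/\ proper_interval I, smooth_in I c
    & forall t, I t -> mink (derive_in I c t) (derive_in I c t) = -1].

Definition smooth_apparatus I F : Prop :=
  [/\ smooth_in I (fT F), smooth_in I (fN F), smooth_in I (fB1 F)
    & smooth_in I (fB2 F)] /\
  [/\ smooth_in I (k1 F), smooth_in I (k2 F) & smooth_in I (k3 F)].

Definition orthonormal_frame F (t : R) : Prop :=
  [/\ mink (fT F t) (fT F t) = -1, mink (fN F t) (fN F t) = 1,
      mink (fB1 F t) (fB1 F t) = 1 & mink (fB2 F t) (fB2 F t) = 1] /\
  [/\ mink (fT F t) (fN F t) = 0, mink (fT F t) (fB1 F t) = 0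
    & mink (fT F t) (fB2 F t) = 0] /\
  [/\ mink (fN F t) (fB1 F t) = 0, mink (fN F t) (fB2 F t) = 0
    & mink (fB1 F t) (fB2 F t) = 0].

Definition frenet_equations I F (t : R) : Prop :=
  [/\ derive_in I (fT F) t = k1 F t *: fN F t,
      derive_in I (fN F) t = k1 F t *: fT F t + k2 F t *: fB1 F t,
      derive_in I (fB1 F) t = - k2 F t *: fN F t + k3 F t *: fB2 F t
    & derive_in I (fB2 F) t = - k3 F t *: fB1 F t].

(* On I the apparatus F is determined by the curve c. *)
Definition special_timelike_frenet I c F : Prop :=
  [/\ timelike_arclength_curve I c,
      smooth_apparatus I F
    & forall t, I t ->
        [/\ 0 < k1 F t, 0 < k2 F t & k3 F t != 0] /\
        [/\ fT F t = derive_in I c t, orthonormal_frame F t,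
            positively_oriented (fT F t) (fN F t) (fB1 F t) (fB2 F t)
          & frenet_equations I F t]].

(* Arc length, measured from t0, of the curve t |-> c t + beta t *: N t. *)
Definition mate_arclength I c F (beta : R -> R) (t0 t : R) : R :=
  oriented_integral
    (fun s => mnorm (derive_in I (fun x => c x + beta x *: fN F x) s)) t0 t.

(* The starred data are the mate curve.  The base point t0 of the arc length
   is 0 when 0 is in I; any base point of I is allowed, because I need not
   contain 0, and changing t0 only translates the parameter of the mate. *)
Definition generalized_timelike_mannheim_mate I c F
    (Is : set R) (cs : R -> 'rV[R]_4) (Fs : frenet_apparatus R) : Prop :=
  special_timelike_frenet Is cs Fs /\
  exists (beta : R -> R) (t0 : R) (phi : 'rV[R]_4 -> 'rV[R]_4),
    let f := mate_arclength I c F beta t0 in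
    [/\ smooth_in I beta, I t0, set_bij (c @` I) (cs @` Is) phi
      & forall t, I t ->
          [/\ Is (f t), cs (f t) = c t + beta t *: fN F t,
              phi (c t) = cs (f t)
            & line_through (c t) (fN F t) `<=`
              plane_through (cs (f t)) (fB1 Fs (f t)) (fB2 Fs (f t))]].

Definition generalized_timelike_mannheim I c F : Prop :=
  special_timelike_frenet I c F /\
  exists (Is : set R) (cs : R -> 'rV[R]_4) (Fs : frenet_apparatus R),
    generalized_timelike_mannheim_mate I c F Is cs Fs.

End FrenetCurves.

(* Main.v *)
(* Write f for the arc length of the mate and v = (c + beta N)', so that
   v = f' T*(f).  The inclusion of the normal line in the plane of B1*, B2* makes
   N orthogonal to T*(f) and N*(f).  From <v, N> = 0 we get beta' = 0.
   Differentiating <T*(f), N> = 0, the term f' k1* <N*(f), N> vanishes and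
   <T*(f), N'> = 0 remains; multiplied by f', this is
   <(1 + beta k1) T + beta k2 B1, k1 T + k2 B1> = 0, which is the claim.
   Only the first derivative of f occurs, so the lack of smoothness of the square
   root at 0 in the arc length is harmless. *)
Require Import Defs.
From HB Require Import structures.
From mathcomp Require Import all_boot all_order all_algebra.
From mathcomp Require Import all_classical all_reals all_analysis.
From mathcomp Require Import ring lra.

Set Implicit Arguments.
Unset Strict Implicit.
Unset Printing Implicit Defensive.

Import Order.TTheory GRing.Theory Num.Theory.
Import numFieldNormedType.Exports.

Local Open Scope classical_set_scope.
Local Open Scope ring_scope.

Lemma near_eq_cvg_to (T U : Type) (F : set_system T) (G : set_system U)
    (f g : T -> U) {FF : Filter F} :
  {near F, f =1 g} -> f @ F `=>` G -> g @ F `=>` G.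
Proof. by move=> fg; apply: cvg_trans; exact: near_eq_cvg. Qed.

(** * Derivatives relative to an interval, one-sided at its endpoints *)

Section RelativeDerivative.
Variable R : realType.
Implicit Types (I : set R) (g : R -> R).

Definition increments I (t : R) : set_system R :=
  within [set h : R | I (t + h)] (0 : R)^'.

#[local] Instance increments_filter I t : Filter (increments I t).
Proof. exact: within_filter. Qed.

Lemma near_increments I t (P : set R) :
  (\forall h \near increments I t, P h) <->
  exists2 d : R, 0 < d & forall h, `|h| < d -> h != 0 -> I (t + h) -> P h.
Proof.
split=> [/nbhs_ballP[d /= d0 hd]|[d d0 hd]].
  by exists d => // h hh; apply: hd; rewrite /ball /= sub0r normrN.
apply/nbhs_ballP; exists d => //= h.
by rewrite /ball /= sub0r normrN => hh h0 Ih; exact: hd.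
Qed.

(** Existence and value of the derivative in one relation, so that the calculus rules can be stated
    without [lim]. *)
Definition has_derive_in (V : normedModType R) I (f : R -> V) (t : R) (l : V) :=
  (fun h : R => h^-1 *: (f (t + h) - f t)) @ increments I t --> l.

(** Properness is what makes limits, hence relative derivatives, unique. A point of [I] other than
    [t] is contracted towards [t]; convexity keeps it in [I]. *)
Lemma increments_proper I t : proper_interval I -> I t ->
  ProperFilter (increments I t).
Proof.
move=> [hI [a [b [Ia Ib ab]]]] It; apply: Build_ProperFilter_ex => P.
move=> /near_increments[e e0 He].
have [s [Is st]] : exists s, I s /\ s != t.
  case: (eqVneq a t) => [at_|]; last by exists a.
  by exists b; split => //; rewrite -at_ gt_eqF.
have n0 : 0 < `|s - t| by rewrite normr_gt0 subr_eq0.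
(* The bound 1/2 keeps [t + k * (s - t)] between [t] and [s]; the other bound makes the increment at
   most [e / 2] in absolute value. *)
pose k := Num.min (1/2) (e / 2 / `|s - t|).
have k0 : 0 < k by rewrite lt_min !divr_gt0.
have k1 : k <= 1/2 by rewrite ge_min lexx.
have k2 : k * `|s - t| <= e / 2.
  by rewrite -ler_pdivlMr // ge_min lexx orbT.
exists (k * (s - t)); apply: He => /=.
- rewrite normrM (gtr0_norm k0); lra.
- by rewrite mulf_neq0 ?subr_eq0 // gt_eqF.
- by case: (ltP s t) => hst; [apply: (hI s t)|apply: (hI t s)] => //;
    apply/andP; split; nra.
Qed.

Lemma has_derive_in_unique (V : normedModType R) I (f : R -> V) t l l' :
  proper_interval I -> I t -> has_derive_in I f t l -> has_derive_in I f t l' ->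
  l = l'.
Proof.
move=> pI It h1 h2; have PF := increments_proper pI It.
exact: (cvg_unique _ h1 h2).
Qed.

Lemma has_derive_in_eq (V : normedModType R) I (f : R -> V) t l :
  proper_interval I -> I t -> has_derive_in I f t l -> derive_in I f t = l.
Proof.
move=> pI It h1; have PF := increments_proper pI It.
exact: (cvg_lim _ h1).
Qed.

Lemma smooth_in_has_derive (V : normedModType R) I (f : R -> V) t :
  smooth_in I f -> I t -> has_derive_in I f t (derive_in I f t).
Proof. by move=> sf It; exact: (sf 0 t It). Qed.

Lemma smooth_in_derive_in (V : normedModType R) I (f : R -> V) :
  smooth_in I f -> smooth_in I (derive_in I f).
Proof. by move=> sf n t It; have := sf n.+1 t It; rewrite iterSr. Qed.

Lemma near_has_derive_in (V : normedModType R) I (f : R -> V) t l q :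
  {near increments I t, q =1 (fun h => h^-1 *: (f (t + h) - f t))} ->
  q @ increments I t --> l -> has_derive_in I f t l.
Proof. exact: near_eq_cvg_to. Qed.

Lemma has_derive_in_ext (V : normedModType R) I (f g : R -> V) t l :
  I t -> (forall x, I x -> f x = g x) ->
  has_derive_in I f t l -> has_derive_in I g t l.
Proof.
move=> It fg; apply: near_has_derive_in.
by apply/near_increments; exists 1 => // h _ _ Ih; rewrite !fg.
Qed.

Lemma has_derive_in_cst (V : normedModType R) I (v : V) t :
  has_derive_in I (fun=> v) t 0.
Proof.
by apply: cvg_near_cst; apply: filterE => h; rewrite subrr scaler0.
Qed.

Lemma has_derive_inD (V : normedModType R) I (f g : R -> V) t l m :
  has_derive_in I f t l -> has_derive_in I g t m ->
  has_derive_in I (fun x => f x + g x) t (l + m).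
Proof.
move=> hf hg; apply: (near_has_derive_in _ (cvgD hf hg)).
by apply: filterE => h; rewrite fctE -scalerDr opprD addrACA.
Qed.

Lemma has_derive_in_sum (V : normedModType R) (T : Type) (r : seq T) I
    (f : T -> R -> V) t (l : T -> V) :
  (forall i, has_derive_in I (f i) t (l i)) ->
  has_derive_in I (fun x => \sum_(i <- r) f i x) t (\sum_(i <- r) l i).
Proof.
move=> hf; elim: r => [|i r IH].
  rewrite big_nil (_ : (fun x => _) = fun=> 0); first exact: has_derive_in_cst.
  by apply/funext => x; rewrite big_nil.
rewrite big_cons (_ : (fun x => _) = fun x => f i x + \sum_(j <- r) f j x).
  exact: has_derive_inD.
by apply/funext => x; rewrite big_cons.
Qed.

Lemma has_derive_in_cvg0 (V : normedModType R) I (f : R -> V) t l :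
  has_derive_in I f t l -> (fun h : R => f (t + h)) @ increments I t --> f t.
Proof.
move=> hf.
have id0 : h @[h --> increments I t] --> (0 : R).
  apply/cvgrPdist_lt => e e0; apply/near_increments; exists e => // h.
  by rewrite sub0r normrN.
rewrite -[X in _ --> X]addr0 -(scale0r l).
apply: (near_eq_cvg_to _ (cvgD (cvg_cst (f t)) (cvgZ id0 hf))).
apply/near_increments; exists 1 => // h _ h0 _.
by rewrite fctE scalerA mulfV // scale1r addrC subrK.
Qed.

(** Passes from the punctured filter of increments to the full neighbourhoods of [t] in [I], the
    form in which continuity on a subspace is expressed. *)
Lemma has_derive_in_cvg (V : normedModType R) I (f : R -> V) t l :
  has_derive_in I f t l -> f s @[s --> within I (nbhs t)] --> f t.
Proof.
move=> /has_derive_in_cvg0 /cvgrPdist_lt h; apply/cvgrPdist_lt => e e0.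
have /near_increments[d d0 hd] := h e e0.
rewrite near_withinE; apply/nbhs_ballP; exists d => //= s ts Is.
case: (eqVneq s t) => [->|st]; first by rewrite subrr normr0.
have := hd (s - t); rewrite [t + _]addrC subrK; apply => //.
- by rewrite distrC.
- by rewrite subr_eq0.
Qed.

Lemma has_derive_inZ (V : normedModType R) I (k : R -> R) (f : R -> V) t l m :
  has_derive_in I k t l -> has_derive_in I f t m ->
  has_derive_in I (fun x => k x *: f x) t (k t *: m + l *: f t).
Proof.
move=> hk hf.
(* The quotient of the product is split as [k t] times the quotient of [f], plus the quotient of [k]
   times [f (t + h)]. *)
apply: (near_has_derive_in _ (cvgD (cvgZ (cvg_cst (k t)) hf)
  (cvgZ hk (has_derive_in_cvg0 hf)))).
apply: filterE => h; rewrite fctE.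
rewrite scalerA (mulrC (k t)) -!scalerA -scalerDr; congr (_ *: _).
by rewrite scalerBr scalerBl addrC addrA subrK.
Qed.

Lemma has_derive_in_comp (V : normedModType R) I J (f : R -> R) (g : R -> V) t l m :
  (forall x, I x -> J (f x)) ->
  has_derive_in I f t l -> has_derive_in J g (f t) m ->
  has_derive_in I (fun x => g (f x)) t (l *: m).
Proof.
move=> IJ hf hg.
(* The increment f (t + h) - f t may vanish, so the slope of g at f t is
   extended by its limit m there. *)
pose q k := if k == 0 then m else k^-1 *: (g (f t + k) - g (f t)).
have hq : (fun h : R => q (f (t + h) - f t)) @ increments I t --> m.
  apply/cvgrPdist_lt => e e0; move/cvgrPdist_lt : hg => /(_ e e0).
  move=> /near_increments[d d0 hd].
  move/cvgrPdist_lt : (has_derive_in_cvg0 hf) => /(_ d d0).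
  move=> /near_increments[r r0 hr]; apply/near_increments; exists r => // h hh h0 Ih.
  rewrite /q; case: eqVneq => [|n0]; first by rewrite subrr normr0.
  apply: (hd (f (t + h) - f t)) => //=; last by rewrite addrC subrK; exact: IJ.
  by rewrite distrC; exact: hr.
apply: (near_has_derive_in _ (cvgZ hf hq)).
apply: filterE => h /=; rewrite /q; case: eqVneq => [h0|n0].
  move/eqP: h0; rewrite subr_eq0 => /eqP ->.
  by rewrite !subrr !scaler0 scale0r.
rewrite [f t + _]addrC subrK [h^-1 *: (f _ - _)]/GRing.scale /=.
by rewrite scalerA mulfK.
Qed.

Lemma has_derive_in_coord m n I (f : R -> 'M[R]_(m.+1, n.+1)) t l i j :
  has_derive_in I f t l -> has_derive_in I (fun x => f x i j) t (l i j).
Proof.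
move=> hf.
apply: (near_has_derive_in _ (cvg_comp _ _ hf (@coord_continuous R _ _ i j l))).
by apply: filterE => h /=; rewrite !mxE.
Qed.

Lemma has_derive_in_mink I (u v : R -> 'rV[R]_4) t l m :
  has_derive_in I u t l -> has_derive_in I v t m ->
  has_derive_in I (fun x => mink (u x) (v x)) t (mink (u t) m + mink l (v t)).
Proof.
move=> hu hv; rewrite /mink -big_split /=; apply: has_derive_in_sum => i.
have hui := @has_derive_in_coord _ _ _ _ _ _ ord0 i hu.
have hvi := @has_derive_in_coord _ _ _ _ _ _ ord0 i hv.
have := has_derive_inZ
  (has_derive_inZ (has_derive_in_cst I ((-1) ^+ (i == ord0) : R) t) hui) hvi.
by rewrite /GRing.scale /= mul0r addr0.
Qed.

(** The mean value theorem on a segment inside [I]: at its interior points the relative derivative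
    is the ordinary one, and at its endpoints continuity suffices. *)
Lemma has_derive_in_eq0_cst I (f : R -> R) : proper_interval I ->
  (forall t, I t -> has_derive_in I f t 0) ->
  forall s t, I s -> I t -> f s = f t.
Proof.
move=> [hI _] hf.
suff H s t : I s -> I t -> s < t -> f s = f t.
  move=> s t Is It; case: (ltgtP s t) => [|ts|->//]; first exact: H.
  by rewrite (H t s).
move=> Is It st.
have sub x : s <= x <= t -> I x by move=> /(hI _ _ Is It).
have [||x _] := @MVT R f (fun=> 0) s t st.
- move=> x; rewrite in_itv /= => /andP[sx xt].
  have dx : h^-1 *: ((f \o shift x) (h *: 1) - f x) @[h --> (0:R)^'] --> (0 : R).
    have /cvgrPdist_lt hx : has_derive_in I f x 0 by apply/hf/sub; rewrite !ltW.
    apply/cvgrPdist_lt => e e0.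
    have /near_increments[d d0 hd] := hx e e0.
    rewrite near_withinE; apply/nbhs_ballP.
    (* The last two radii keep [x + h] in the segment from [s] to [t], so that the restriction of
       increments to [I] holds automatically. *)
    exists (Num.min d (Num.min (x - s) (t - x))) => /=.
      by rewrite !lt_min d0 !subr_gt0 sx xt.
    move=> h; rewrite /ball /= sub0r normrN !lt_min => /and3P[hd1 h1 h2] h0.
    rewrite [h *: 1]mulr1 [h + x]addrC; apply: hd => //.
    by apply: sub; move: h1 h2; rewrite !ltr_norml; lra.
  by apply: DeriveDef; [apply/cvg_ex; exists 0 | exact: cvg_lim dx].
- have cf : {within I, continuous f}.
    by apply/subspace_continuousP => x Ix; exact: has_derive_in_cvg (hf x Ix).
  by apply: continuous_subspaceW cf => x; rewrite /= in_itv; exact: sub.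
by rewrite mul0r => /subr0_eq.
Qed.

(** * Oriented integrals and the fundamental theorem of calculus *)

Lemma integrable_segment_in I g a b : is_interval I -> {within I, continuous g} ->
  I a -> I b -> lebesgue_measure.-integrable `[a, b] (EFin \o g).
Proof.
move=> hI cg Ia Ib; apply: continuous_compact_integrable; first exact: segment_compact.
by apply: continuous_subspaceW cg => x; rewrite /= in_itv => /(hI _ _ Ia Ib).
Qed.

Lemma oriented_integral_cat I g x y z : is_interval I ->
  {within I, continuous g} -> I x -> I y -> I z ->
  oriented_integral g x y + oriented_integral g y z = oriented_integral g x z.
Proof.
move=> hI cg.
have cat a b c : I a -> I b -> I c -> a <= b -> b <= c ->
    \int[lebesgue_measure]_(t in `[a, c]) g t =
    \int[lebesgue_measure]_(t in `[a, b]) g t +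
    \int[lebesgue_measure]_(t in `[b, c]) g t.
  move=> Ia Ib Ic ab bc.
  have iac := integrable_segment_in hI cg Ia Ic.
  (* The difference of the integrals is over the half-open interval from [b] to [c]; adding the
     endpoint [b] does not change it. *)
  have := Rintegral_itvB iac; move=> /(_ b); rewrite !bnd_simp => /(_ ab bc) e.
  rewrite -(@Rintegral_itv_obnd_cbnd _ b); first by rewrite -e addrC subrK.
  by apply: integrableS (integrable_segment_in hI cg Ib Ic) => //;
    exact: subset_itv_oc_cc.
have int1 a : \int[lebesgue_measure]_(t in `[a, a]) g t = 0.
  by rewrite set_itv1 Rintegral_set1.
move=> Ix Iy Iz; rewrite /oriented_integral.
(* Of the eight order patterns two are contradictory; each other one is [cat] for the sorted triple,
   up to signs. *)
have [xy|yx] := leP x y; have [yz|zy] := leP y z; have [xz|zx] := leP x z.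
- by rewrite -cat.
- lra.
- by rewrite (cat x z y) // 1?ltW //; lra.
- by rewrite (cat z x y) // 1?ltW //; lra.
- by rewrite (cat y x z) // 1?ltW //; lra.
- by rewrite (cat y z x) // 1?ltW //; lra.
- lra.
- by rewrite (cat z y x) // 1?ltW //; lra.
Qed.

(** Between the two bounds [g] lies between the constants [m - e] and [m + e], whose integrals are
    explicit; monotonicity of the integral concludes. *)
Lemma oriented_integral_dist I g (x y m e : R) : is_interval I ->
  {within I, continuous g} -> I x -> I y ->
  (forall s, Num.min x y <= s <= Num.max x y -> `|g s - m| <= e) ->
  `|oriented_integral g x y - (y - x) * m| <= e * `|y - x|.
Proof.
move=> hI cg.
have H a b : I a -> I b -> a <= b -> (forall s, a <= s <= b -> `|g s - m| <= e) ->
    `|\int[lebesgue_measure]_(t in `[a, b]) g t - (b - a) * m| <= e * (b - a).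
  move=> Ia Ib ab hs.
  have mes : measurable (`[a, b] : set (measurableTypeR R)) by [].
  have leb : lebesgue_measure (`[a, b]%classic : set R) = (b - a)%:E.
    rewrite lebesgue_measure_itv /= lte_fin.
    case: ltP => [//|ba]; rewrite (_ : b = a) ?subrr //.
    by apply/le_anti; rewrite ab ba.
  have ic (r : R) : \int[lebesgue_measure]_(t in `[a, b]) r = r * (b - a).
    rewrite Rintegral_cst //; congr (_ * _); exact: (congr1 fine leb).
  have intc (r : R) : lebesgue_measure.-integrable `[a, b] (EFin \o (fun=> r)).
    apply: continuous_compact_integrable; first exact: segment_compact.
    by apply: continuous_subspaceT => ?; exact: cvg_cst.
  have ig := integrable_segment_in hI cg Ia Ib.
  have l1 := le_Rintegral mes (intc (m - e)) ig.
  have l2 := le_Rintegral mes ig (intc (m + e)).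
  rewrite ic in l1; rewrite ic in l2.
  rewrite ler_norml; apply/andP; split.
    suff : (m - e) * (b - a) <= \int[lebesgue_measure]_(t in `[a, b]) g t by nra.
    by apply: l1 => s /=; rewrite in_itv /= => /hs; rewrite ler_norml; lra.
  suff : \int[lebesgue_measure]_(t in `[a, b]) g t <= (m + e) * (b - a) by nra.
  by apply: l2 => s /=; rewrite in_itv /= => /hs; rewrite ler_norml; lra.
move=> Ix Iy; rewrite /oriented_integral; have [xy|yx] := leP x y => hs.
  rewrite (ger0_norm (_ : 0 <= y - x)) ?subr_ge0 //; exact: H.
rewrite (distrC y x) (gtr0_norm (_ : 0 < x - y)) ?subr_gt0 //.
by rewrite -opprD normrN -[y - x]opprB mulNr; apply: H => //; exact: ltW.
Qed.

(** By additivity the increment of the primitive is the integral from [t] to [t + h], where [g] is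
    within [e] of [g t] for small [h]. Continuity relative to [I] is enough, so endpoints are
    covered. *)
Lemma has_derive_in_oriented_integral I g a t : is_interval I ->
  {within I, continuous g} -> I a -> I t ->
  has_derive_in I (oriented_integral g a) t (g t).
Proof.
move=> hI cg Ia It; apply/cvgrPdist_le => e e0.
move/subspace_continuousP : (cg) => /(_ t It) /cvgrPdist_le /(_ e e0).
rewrite near_withinE => /nbhs_ballP[d /= d0 hd].
apply/near_increments; exists d => // h hh h0 Ih.
have -> : oriented_integral g a (t + h) - oriented_integral g a t =
    oriented_integral g t (t + h).
  by rewrite -(oriented_integral_cat hI cg Ia It Ih) addrC addKr.
have := @oriented_integral_dist I g t (t + h) (g t) e hI cg It Ih.
rewrite [t + h - t]addrC addKr => H.
(* Multiplying by the norm of [h] clears the difference quotient and leaves the estimate for the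
   integral. *)
rewrite -(ler_pM2r (_ : 0 < `|h|)) ?normr_gt0 // -normrM mulrBl.
rewrite /GRing.scale /= mulrAC mulVf // mul1r distrC (mulrC (g t)).
apply: H => s hs; rewrite distrC; apply: hd.
  move: hs hh; rewrite /ball /= !ltr_norml minElt maxElt.
  by case: (ltP t (t + h)); lra.
by move: hs; rewrite minElt maxElt; case: ltP => ? hs;
  [apply: (hI t (t + h))|apply: (hI (t + h) t)].
Qed.

End RelativeDerivative.

(** * Bilinearity of the Minkowski form and orthogonality to a plane *)

Section Mannheim.
Variable R : realType.
Implicit Types u v w : 'rV[R]_4.

Lemma minkC u v : mink u v = mink v u.
Proof. by apply: eq_bigr => i _; rewrite -!mulrA (mulrC (u _ _)). Qed.

Lemma minkDl u v w : mink (u + v) w = mink u w + mink v w.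
Proof. by rewrite -big_split; apply: eq_bigr => i _; rewrite mxE mulrDr mulrDl. Qed.

Lemma minkZl a u v : mink (a *: u) v = a * mink u v.
Proof. by rewrite mulr_sumr; apply: eq_bigr => i _; rewrite mxE mulrCA !mulrA. Qed.

Lemma minkDr u v w : mink u (v + w) = mink u v + mink u w.
Proof. by rewrite minkC minkDl !(minkC u). Qed.

Lemma minkZr a u v : mink u (a *: v) = a * mink u v.
Proof. by rewrite minkC minkZl minkC. Qed.

Definition minkE := (minkDl, minkDr, minkZl, minkZr).

(** The direction [v] is the difference of two points of the line; both lie in the plane, so [v] is
    a combination of [w1] and [w2]. *)
Lemma line_subset_plane_mink_eq0 (p q v w1 w2 u : 'rV[R]_4) :
  line_through p v `<=` plane_through q w1 w2 ->
  mink u w1 = 0 -> mink u w2 = 0 -> mink u v = 0.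
Proof.
move=> sub u1 u2.
have [|a0 [b0 e0]] := sub p; first by exists 0; rewrite // scale0r addr0.
have [|a1 [b1 e1]] := sub (p + v); first by exists 1; rewrite // scale1r.
have -> : v = (p + v) + (-1) *: p by rewrite scaleN1r addrC addKr.
by rewrite e1 {1}e0 !minkE u1 u2; ring.
Qed.

End Mannheim.

(** * The curvature relation *)

Theorem theorem3p1 (R : realType) (I : set R) (c : R -> 'rV[R]_4)
    (F : frenet_apparatus R)
    (hC : special_timelike_frenet I c F)
    (hM : generalized_timelike_mannheim I c F) :
  exists beta : R, forall t : R, I t ->
    k1 F t = - beta * (k1 F t ^+ 2 - k2 F t ^+ 2).
Proof.
case: hM => _ [Is [cs [Fs [hCs [beta [t0 [phi [sb It0 _ mate]]]]]]]].
case: hC => -[pI sc _] [[sT sN _ _] _] frF.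
case: hCs => -[pIs scs _] [[sTs _ _ _] _] frFs.
have hI : is_interval I by case: pI.
set f := mate_arclength I c F beta t0 in mate.
pose N' := derive_in I (fN F); pose beta' := derive_in I beta.
pose v t := fT F t + (beta t *: N' t + beta' t *: fN F t).
have dN t : I t -> has_derive_in I (fN F) t (N' t).
  exact: smooth_in_has_derive.
have dv t : I t -> has_derive_in I (fun x => c x + beta x *: fN F x) t (v t).
  move=> It; have [_ [eT _ _ _]] := frF t It; rewrite /v eT.
  by apply: has_derive_inD; [|apply: has_derive_inZ]; exact: smooth_in_has_derive.
pose speed s := mnorm (derive_in I (fun x => c x + beta x *: fN F x) s).
have speedE s : I s -> speed s = mnorm (v s).
  by move=> Is_; rewrite /speed (has_derive_in_eq pI Is_ (dv s Is_)).
have speed_cont : {within I, continuous speed}.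
  apply/subspace_continuousP => t It.
  (* Only the existence of this derivative matters: it makes the square of [v] continuous, hence
     also [mnorm] of [v]. *)
  have dvt : has_derive_in I v t _ := has_derive_inD
    (smooth_in_has_derive sT It)
    (has_derive_inD
      (has_derive_inZ (smooth_in_has_derive sb It)
        (smooth_in_has_derive (smooth_in_derive_in sN) It))
      (has_derive_inZ (smooth_in_has_derive (smooth_in_derive_in sb) It)
        (dN t It))).
  suff : speed s @[s --> within I (nbhs t)] --> speed t by [].
  rewrite speedE //.
  have cm := has_derive_in_cvg (has_derive_in_mink dvt dvt).
  have cs' : mnorm (v s) @[s --> within I (nbhs t)] --> mnorm (v t).
    exact: (cvg_comp _ _ (cvg_norm cm) (@sqrt_continuous R _)).
  (* [speed] and [mnorm] of [v] are known to agree only on [I], which the filter within [I]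
     allows. *)
  apply: near_eq_cvg_to cs'.
  by rewrite near_withinE; apply: filterE => s Is_; rewrite speedE.
have df t : I t -> has_derive_in I f t (speed t).
  by move=> It; exact: has_derive_in_oriented_integral.
have fI x : I x -> Is (f x) by move=> /mate[].
(* The curve [c + beta N] is differentiated twice: directly, and by the chain rule as [cs] composed
   with [f]. Uniqueness of the derivative equates the results. *)
have vE t : I t -> v t = speed t *: fT Fs (f t).
  move=> It; have Isf := fI t It; have [_ [eT _ _ _]] := frFs _ Isf.
  apply: (has_derive_in_unique pI It (dv t It)).
  rewrite eT; apply: (has_derive_in_ext It _
    (has_derive_in_comp fI (df t It) (smooth_in_has_derive scs Isf))).
  by move=> x /mate[].
have TsN t : I t -> mink (fT Fs (f t)) (fN F t) = 0.
  move=> It; have [Isf _ _ sub] := mate t It.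
  have [_ [_ [_ [[_ TB1 TB2] _]] _ _]] := frFs _ Isf.
  exact: line_subset_plane_mink_eq0 sub TB1 TB2.
have NsN t : I t -> mink (fN Fs (f t)) (fN F t) = 0.
  move=> It; have [Isf _ _ sub] := mate t It.
  have [_ [_ [_ [_ [NB1 NB2 _]]] _ _]] := frFs _ Isf.
  exact: line_subset_plane_mink_eq0 sub NB1 NB2.
have N'E t : I t -> N' t = k1 F t *: fT F t + k2 F t *: fB1 F t.
  by move=> It; have [_ [_ _ _ []]] := frF t It.
have beta'0 t : I t -> beta' t = 0.
  (* Multiplying by [speed t] replaces the mate's tangent by [v t] without any division; the product
     of [v t] with [fN F t] is then just [beta' t]. *)
  move=> It; have := TsN t It => /(congr1 ( *%R (speed t))).
  rewrite -minkZl -vE // /v N'E // mulr0 !minkE.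
  have [_ [_ [[_ -> _ _] [[-> _ _] [NB1 _ _]]] _ _]] := frF t It.
  by rewrite (minkC (fB1 F t)) NB1; lra.
have beta_cst s t : I s -> I t -> beta s = beta t.
  apply: has_derive_in_eq0_cst => // x Ix; rewrite -(beta'0 x Ix).
  exact: smooth_in_has_derive.
(* The base point of the arc length serves as a point of [I] at which to evaluate the constant
   function [beta]. *)
exists (beta t0) => t It; rewrite (beta_cst t0 t It0 It).
have Isf := fI t It.
have TsN' : mink (fT Fs (f t)) (N' t) = 0.
  have [_ [_ _ _ [eT' _ _ _]]] := frFs _ Isf.
  have dTs : has_derive_in I (fun x => fT Fs (f x)) t
      (speed t *: (k1 Fs (f t) *: fN Fs (f t))).
    rewrite -eT'.
    exact: (has_derive_in_comp fI (df t It) (smooth_in_has_derive sTs Isf)).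
  (* The product vanishes on all of [I], so its derivative is 0; the product rule gives a second
     expression for it. *)
  have d0 : has_derive_in I (fun x => mink (fT Fs (f x)) (fN F x)) t 0.
    apply: (has_derive_in_ext It _ (has_derive_in_cst I 0 t)).
    by move=> x Ix; rewrite TsN.
  have := has_derive_in_unique pI It (has_derive_in_mink dTs (dN t It)) d0.
  by rewrite !minkZl NsN // !mulr0 addr0.
(* After multiplication by [speed t], the signs -1 of [T] and +1 of [B1] give -(1 + beta k1) k1 +
   beta k2^2 = 0. *)
have := congr1 ( *%R (speed t)) TsN'.
rewrite -minkZl -vE // /v beta'0 // N'E // mulr0 scale0r addr0 !minkE.
have [_ [_ [[-> _ -> _] [[_ TB1 _] _]] _ _]] := frF t It.
by rewrite (minkC (fB1 F t)) TB1; lra.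
Qed.
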